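(* Let $B$ be a finite ring with $2\in B^\times$, having an involution $*$ and a primitive group homomorphism $\beta:B^+\to\mathbb{C}^\times$ such that $\beta(b-b^* )=1$ for all $b\in B$. Let $m\geq 1$ and suppose $T\in\mathrm{GL}(m,B)$ satisfies $T^*=T$. Then $$\sum_{b\in B^m}\beta(b^*Tb)=\sum_{b\in B^m}\beta(b^*T^{-1}b)=\mu(T)\sum_{b\in B^m}\beta(b^*b),$$ $$\Big(\sum_{b\in B^m}\beta(b^*Tb)\Big)^2=(-1)^{\frac{|B|^m-1}{2}}|B|^m.$$
   Context: Rings have identity $1\ne0$ and need not be commutative; an involution is an antiautomorphism of order 1 or 2, extended to $M(m,B)$ by $(x^* )_{ij}=(x_{ji})^*$. $\beta$ is primitive if its kernel contains no right ideal of $B$ other than $(0)$. $B^m$ is the space of column vectors, and $b^*$ denotes the row vector $(b_1^*,\dots,b_m^* )$. Let $I\subset B^m\setminus\{0\}$ contain exactly one element of each set $\{v,-v\}$, $0\neq v\in B^m$. For $Y\in\mathrm{GL}(m,B)$ put $I_Y=\{v\in I:Yv\in-I\}$ and $\mu(Y)=(-1)^{|I_Y|}$; $\mu$ is a group homomorphism $\mathrm{GL}(m,B)\to\{1,-1\}$ independent of the choice of $I$. *)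

(* Defs.v *)
From HB Require Import structures.
From mathcomp Require Import all_boot all_order all_algebra.
From mathcomp Require Import reals complex.

Set Implicit Arguments.
Unset Strict Implicit.
Unset Printing Implicit Defensive.

Import GRing.Theory Num.Theory.

Local Open Scope ring_scope.

Definition ring_involution (B : nzRingType) (star : B -> B) : Prop :=
  [/\ {morph star : x y / x + y},
      forall x y, star (x * y) = star y * star x,
      star 1 = 1 &
      involutive star].

Definition additive_character (B : nzRingType) (C : fieldType) (beta : B -> C)
    : Prop :=
  (forall x, beta x != 0) /\ {morph beta : x y / x + y >-> x * y}.

(* [ring_quotient] only provides left ideals (of noncommutative rings). *)
Definition right_ideal (B : finNzRingType) (J : {set B}) : Prop :=
  zmod_closed J /\ forall x b : B, x \in J -> x * b \in J.

Definition primitive (B : finNzRingType) (C : fieldType) (beta : B -> C)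
    : Prop :=
  forall J : {set B},
    right_ideal J -> (forall x, x \in J -> beta x = 1) -> J = [set 0].

(* For a column vector b, [adjmx star b] is the row vector b^*. *)
Definition adjmx (B : nzRingType) (star : B -> B) (p q : nat)
    (x : 'M[B]_(p, q)) : 'M[B]_(q, p) :=
  \matrix_(i, j) star (x j i).

(* [unitmx] and [invmx] rely on determinants, hence on commutative
   coefficients; over a noncommutative finite ring, invertibility is the
   existence of a two-sided inverse, found by enumeration as in [finalg]. *)
Definition mx_inverses (B : finNzRingType) (m : nat) (X Y : 'M[B]_m) : bool :=
  (X *m Y == 1%:M) && (Y *m X == 1%:M).

Definition GLmx (B : finNzRingType) (m : nat) : {set 'M[B]_m} :=
  [set X : 'M[B]_m | [exists Y : 'M[B]_m, mx_inverses X Y]].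

(* The default value X is only used when X is not in GL(m, B). *)
Definition GLinv (B : finNzRingType) (m : nat) (X : 'M[B]_m) : 'M[B]_m :=
  odflt X [pick Y : 'M[B]_m | mx_inverses X Y].

(* The value of the form attached to X at b: the entry of the 1 x 1 matrix
   b^* X b. *)
Definition herm_form (B : nzRingType) (star : B -> B) (m : nat)
    (X : 'M[B]_m) (b : 'cV[B]_m) : B :=
  (adjmx star b *m X *m b) 0 0.

(* Such a set I exists as soon as v <> - v for all v <> 0, in particular when
   2 is a unit of B. *)
Definition half_system (B : finNzRingType) (m : nat) (I : {set 'cV[B]_m})
    : Prop :=
  0 \notin I /\ forall v : 'cV[B]_m, v != 0 -> #|I :&: [set v; - v]| = 1%N.

Definition mu (B : finNzRingType) (m : nat) (I : {set 'cV[B]_m})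
    (Y : 'M[B]_m) : int :=
  (-1) ^+ #|[set v in I | Y *m v \in [set - w | w in I]]|.

(* Main.v *)
Require Import Defs.
From mathcomp Require Import all_boot all_order all_algebra.
From mathcomp Require Import reals complex.
From mathcomp Require Import perm ring.

(** Let [V] be a finite abelian group with a half-set [I] (so that
[N = #|V| = 2 n + 1] with [n = #|I|]), let [q] be an even quadratic character
of [V] with nondegenerate bicharacter [k x y = q (x + y) / (q x * q y)], and
let [G] be the sum of all [q x]. On functions on [V], consider the Fourier
operator [F] with kernel [k] and the multiplication [D] by [q]. They satisfy

  - [F F = N P], where [P] is the reflection [x |-> - x];
  - [D F D F D = G P F], by completing the square ([fourier_chirp]).

Both [F] and [D] preserve the even functions (dimension [n + 1], [P = 1]) and
the odd functions (dimension [n], [P = -1]). On either sector [det D] is the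
product of [q] over [I], and its cube is 1 because doubling permutes [I] up to
signs while [q (2 x) = q x ^ 4] ([chirp_cube]). Taking determinants on both
sectors,

  [det F_even = G^(n+1)],             [det F_odd = (- G)^n],
  [(det F_even)^2 = N^(n+1)],         [(det F_odd)^2 = (- N)^n].

The two exponents of [G] are consecutive, so a division isolates [G] itself:
[G^2 = (-1)^n N] ([gauss_sum_sqr]).

If [q'] is a second character whose bicharacter is [k x (tau y)] for an
injective odd map [tau], then [F'] is [F] followed by the action of [tau] on
functions. In the natural bases of the two sectors that action is the
permutation [sigma] of [I] induced by [tau], with the signs defining [mu] in
the odd case. Hence [G'^(n+1) = sgn(sigma) G^(n+1)] and
[G'^n = mu(tau) sgn(sigma) G^n], and again a division gives [G' = mu(tau) G]
([gauss_sum_act]).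

The theorem is the case [V = B^m], [q b = beta (b^* T b)]; its bicharacter is
[beta (2 x^* T y)], nondegenerate because [beta] is primitive and 2 and [T]
are invertible ([herm_quadratic]). The comparison of [T] with [1] uses
[tau = T], and [T^-1] yields the same sum as [T] through [b |-> T b]. *)

Set Implicit Arguments.
Unset Strict Implicit.
Unset Printing Implicit Defensive.

Import GRing.Theory Num.Theory.

Local Open Scope ring_scope.

(** * Half-sets of a finite abelian group *)

Section HalfSet.
Variable V : finZmodType.
Implicit Types (I : {set V}) (x v : V).

(** Unlike [half_system], this forbids a nonzero [v] with [v = - v], so that it
forces the group to have odd order. *)
Definition half_set I : Prop :=
  0 \notin I /\ forall v, v != 0 -> (- v \in I) = (v \notin I).

Lemma half_set_neq0 I v : half_set I -> v \in I -> v != 0.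
Proof. by case=> I0 _ vI; apply: contraNneq I0 => <-. Qed.

Lemma half_setN I v : half_set I -> v \in I -> - v \notin I.
Proof. by move=> hI vI; rewrite hI.2 ?vI ?(half_set_neq0 hI). Qed.

Lemma half_set_eqN I v : half_set I -> v = - v -> v = 0.
Proof.
move=> hI vN; apply/eqP/negPn/negP => v0.
by have := hI.2 _ v0; rewrite -vN; case: (v \in I).
Qed.

Lemma half_set_inj2 I (x y : V) : half_set I -> x + x = y + y -> x = y.
Proof.
move=> hI xy; apply/eqP; rewrite -subr_eq0; apply/eqP.
apply: (half_set_eqN hI); rewrite opprB; apply/eqP.
by rewrite -subr_eq0 opprB addrACA xy -opprD subrr.
Qed.

(** Every sum over the group, hence every application of an integral kernel,
folds to [I] together with 0. *)
Lemma sum_half_set (U : nmodType) I (f : V -> U) : half_set I ->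
  \sum_x f x = f 0 + \sum_(i < #|I|) (f (enum_val i) + f (- enum_val i)).
Proof.
move=> hI; rewrite (bigD1 0) //= (bigID [in I]) /= big_split /=.
congr (_ + (_ + _)).
  rewrite -(@big_enum_val _ _ _ _ [in I] f).
  apply: eq_bigl => x; case xI: (x \in I); rewrite ?andbF //.
  by rewrite (half_set_neq0 hI xI).
rewrite -(@big_enum_val _ _ _ _ [in I] (fun x => f (- x))).
rewrite (reindex_inj (@oppr_inj V)); apply: eq_bigl => x.
rewrite oppr_eq0; have [->|x0] /= := eqVneq x 0.
  by rewrite (negbTE hI.1).
by rewrite hI.2 // negbK.
Qed.

Lemma card_half_set I : half_set I -> #|V| = (#|I|.*2.+1)%N.
Proof.
move=> hI; have := sum_half_set (fun=> 1 : nat) hI.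
by rewrite !sumr_const card_ord natn -mulr2n -mulrnA mul2n natn => ->.
Qed.

(** An injective odd map permutes the pairs [{v, - v}], and each such pair has
one representative in [I]. *)
Lemma half_set_act I (tau : V -> V) :
    half_set I -> injective tau -> {morph tau : x / - x} ->
  exists sigma : {perm 'I_#|I|}, forall i,
    tau (enum_val i) =
      if tau (enum_val i) \in I then enum_val (sigma i)
      else - enum_val (sigma i).
Proof.
move=> hI tau_inj tauN.
have tau0 : tau 0 = 0 by apply: (half_set_eqN hI); rewrite -tauN oppr0.
(* The representative in I of the pair of v, for v <> 0. *)
pose r v := if v \in I then v else - v.
have rI (i : 'I_#|I|) : r (tau (enum_val i)) \in I.
  rewrite /r; case: ifP => // h; rewrite hI.2 ?h // -tau0 (inj_eq tau_inj).
  exact: half_set_neq0 (enum_valP i).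
pose g i := enum_rank_in (rI i) (r (tau (enum_val i))).
have gE i : enum_val (g i) = r (tau (enum_val i)) by rewrite enum_rankK_in.
have g_inj : injective g.
  move=> i j /(congr1 enum_val); rewrite !gE /r => h.
  have [ij|ij] : enum_val i = enum_val j \/ enum_val i = - enum_val j.
  - move: h; case: ifP => _; case: ifP => _.
    + by move/tau_inj; left.
    + by rewrite -tauN => /tau_inj; right.
    + by rewrite -tauN => /tau_inj <-; right; rewrite opprK.
    + by move/oppr_inj/tau_inj; left.
  - exact: enum_val_inj.
  - have := half_setN hI (enum_valP j); rewrite -ij.
    by rewrite (enum_valP i).
exists (perm g_inj) => i; rewrite permE gE /r.
by case: (_ \in I) => /=; rewrite ?opprK.
Qed.

End HalfSet.

(** * Coordinates on even and odd functions *)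

Section Parity.
Variables (V : finZmodType) (C : numFieldType).

(** A frame for the functions [h] on [V] such that [h (- x) = e * h x]: such an
[h] is recorded by its values at the points [s j], and the weights [w j] make
up for points that coincide with their opposite. [frame_sum] says that an
operator acts in these coordinates through its folded kernel, of which [f] is
one row,
and [frame_delta] that the reflection acts as the scalar [e]. Treating both
parities through this record lets the determinant computations be done once. *)
Record parity_frame (e : C) k (s : 'I_k -> V) (w : 'I_k -> C) : Prop := {
  frame_sign : e * e = 1;
  frame_sum : forall f h : V -> C, (forall x, h (- x) = e * h x) ->
    \sum_(j < k) w j * (f (s j) + e * f (- s j)) * h (s j)
      = \sum_x f x * h x;
  frame_delta : forall i j,
    w j * ((s i == - s j)%:R + e * (s i == s j)%:R) = e * (i == j)%:R }.

Lemma frame_sign_neq0 e k (s : 'I_k -> V) w : parity_frame e s w -> e != 0.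
Proof.
move=> fr; apply/eqP => e0; have /eqP := frame_sign fr.
by rewrite e0 mul0r eq_sym oner_eq0.
Qed.

Lemma odd_frame (I : {set V}) : half_set I ->
  @parity_frame (-1) #|I| enum_val (fun=> 1).
Proof.
move=> hI; split=> [|f h hN|i j]; first by rewrite mulrNN mul1r.
- have h0 : h 0 = 0.
    have /eqP := hN 0; rewrite oppr0 mulN1r -subr_eq0 opprK -mulr2n.
    by rewrite mulrn_eq0 /= => /eqP.
  rewrite (sum_half_set _ hI) h0 mulr0 add0r; apply: eq_bigr => i _.
  by rewrite hN; ring.
- have -> : (enum_val i == - enum_val j) = false.
    apply: contraNF (half_setN hI (enum_valP j)) => /eqP <-.
    exact: enum_valP.
  by rewrite (inj_eq enum_val_inj) add0r mul1r.
Qed.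

(** Putting 0 first makes the permutation induced on the even frame a
[lift0_perm], whose signature is that of the permutation of [I]. *)
Definition even_point (I : {set V}) (i : 'I_#|I|.+1) : V :=
  oapp enum_val 0 (unlift ord0 i).
(** The point 0 is counted twice by the folding [f x + f (- x)]. *)
Definition even_weight n (i : 'I_n.+1) : C := if i == ord0 then 2^-1 else 1.

Lemma even_frame (I : {set V}) : half_set I ->
  parity_frame 1 (@even_point I) (@even_weight #|I|).
Proof.
move=> hI; split=> [|f h hN|i j]; first exact: mulr1.
- rewrite (sum_half_set _ hI) big_ord_recl /even_weight /even_point /=.
  rewrite unlift_none /= oppr0; congr (_ + _).
    by rewrite mul1r -mulr2n -[f 0 *+ 2]mulr_natl mulKf ?pnatr_eq0.
  apply: eq_bigr => i _; rewrite liftK /= hN; ring.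
- rewrite /even_weight /even_point !mul1r.
  case: (unliftP ord0 i) (unliftP ord0 j) => [i'|] -> [j'|] -> /=.
  + have -> : (enum_val i' == - enum_val j') = false.
      apply: contraNF (half_setN hI (enum_valP j')) => /eqP <-.
      exact: enum_valP.
    by rewrite add0r mul1r (inj_eq enum_val_inj) (inj_eq lift_inj).
  + have /negbTE i0 := half_set_neq0 hI (enum_valP i').
    by rewrite oppr0 i0 addr0 mulr0.
  + have /negbTE j0 := half_set_neq0 hI (enum_valP j').
    by rewrite !(eq_sym 0) oppr_eq0 j0 addr0 mulr0.
  + by rewrite oppr0 !eqxx -mulr2n mulVf ?pnatr_eq0.
Qed.

End Parity.

(** * Quadratic characters and their Gauss sums *)

Section Quadratic.
Variables (V : finZmodType) (C : numFieldType).

Record quadratic_character (q : V -> C) (k : V -> V -> C) : Prop := {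
  qchar_neq0 : forall x, q x != 0;
  qcharN : forall x, q (- x) = q x;
  qcharD : forall x y, q (x + y) = q x * q y * k x y;
  bicharDr : forall x y z, k x (y + z) = k x y * k x z;
  bicharC : forall x y, k x y = k y x;
  bichar_nondeg : forall x, (forall y, k x y = 1) -> x = 0 }.

Definition gauss_sum (q : V -> C) : C := \sum_x q x.

(** The matrix, in a parity frame, of the operator with kernel [k]. *)
Definition fourier (e : C) n (s : 'I_n -> V) (w : 'I_n -> C)
    (k : V -> V -> C) : 'M[C]_n :=
  \matrix_(i, j) (w j * (k (s i) (s j) + e * k (s i) (- s j))).

(** The matrix, in a parity frame, of the multiplication by [q]. *)
Definition chirp n (s : 'I_n -> V) (q : V -> C) : 'M[C]_n :=
  diag_mx (\row_i q (s i)).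

Variables (q : V -> C) (k : V -> V -> C).
Hypothesis qk : quadratic_character q k.

Lemma bichar_neq0 x y : k x y != 0.
Proof.
apply: contraTneq (qchar_neq0 qk (x + y)) => kxy.
by rewrite (qcharD qk) kxy mulr0 eqxx.
Qed.

Lemma bichar0r x : k x 0 = 1.
Proof.
apply: (mulfI (bichar_neq0 x 0)).
by rewrite -(bicharDr qk) addr0 mulr1.
Qed.

Lemma bicharDl x y z : k (x + y) z = k x z * k y z.
Proof. by rewrite !(bicharC qk _ z) (bicharDr qk). Qed.

Lemma bicharNr x y : k x (- y) = (k x y)^-1.
Proof.
apply: (mulfI (bichar_neq0 x y)).
by rewrite -(bicharDr qk) subrr bichar0r mulfV // bichar_neq0.
Qed.

Lemma bicharNl x y : k (- x) y = (k x y)^-1.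
Proof. by rewrite !(bicharC qk _ y) bicharNr. Qed.

Lemma qchar0 : q 0 = 1.
Proof.
apply: (mulfI (qchar_neq0 qk 0)).
by have := qcharD qk 0 0; rewrite addr0 bichar0r !mulr1 => <-.
Qed.

Lemma qcharB x y : q (x - y) = q x * q y * (k x y)^-1.
Proof. by rewrite (qcharD qk) (qcharN qk) bicharNr. Qed.

(** Comparing [q (x - x) = 1] with the polarization formula gives
[k x x = q x ^ 2], whence [q x ^ 4] rather than a mere [q x ^ 2 * k x x]. *)
Lemma qchar_double x : q (x + x) = q x ^+ 4.
Proof.
have kxx : k x x = q x * q x.
  have := qcharB x x; rewrite subrr qchar0 => /(congr1 ( *%R^~ (k x x))).
  by rewrite mul1r mulfVK // bichar_neq0.
by rewrite (qcharD qk) kxx; ring.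
Qed.

Lemma bichar_sum a : \sum_x k a x = #|V|%:R * (a == 0)%:R.
Proof.
have [->|a0] := eqVneq a 0.
  rewrite mulr1 -sumr_const; apply: eq_bigr => x _.
  by rewrite (bicharC qk) bichar0r.
have [/forallP h|] := boolP [forall y, k a y == 1].
  by rewrite (bichar_nondeg qk (fun y => eqP (h y))) eqxx in a0.
rewrite negb_forall => /existsP[y ky]; rewrite mulr0; apply/eqP.
have : (k a y - 1) * (\sum_x k a x) = 0.
  apply/eqP; rewrite mulrBl mul1r subr_eq0 mulr_sumr; apply/eqP.
  rewrite [RHS](reindex_inj (addrI y)) /=.
  by apply: eq_bigr => x _; rewrite (bicharDr qk).
by move/eqP; rewrite mulf_eq0 subr_eq0 (negbTE ky).
Qed.


(** Completing the square: [q x * k a x = q (a + x) / q a]. *)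
Lemma gauss_sum_twist a : \sum_x q x * k a x = gauss_sum q * (q a)^-1.
Proof.
rewrite /gauss_sum mulr_suml [RHS](reindex_inj (addrI a)) /=.
apply: eq_bigr => x _; rewrite (qcharD qk); field; exact: (qchar_neq0 qk).
Qed.

(** Fourier inversion: two transforms give [N] times the reflection, which is
the scalar [e] on functions of parity [e]. *)
Lemma fourier_sqr e n (s : 'I_n -> V) w : parity_frame e s w ->
  fourier e s w k *m fourier e s w k = (e * #|V|%:R)%:M.
Proof.
move=> fr; apply/matrixP => i l; rewrite !mxE.
under eq_bigr do rewrite !mxE.
rewrite (frame_sum fr (k (s i))
  (h := fun x => w l * (k x (s l) + e * k x (- s l)))); last first.
  move=> x; rewrite !bicharNl -!bicharNr opprK.
  by rewrite mulrCA; congr (_ * _); rewrite mulrDr mulrA (frame_sign fr) mul1r addrC.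
transitivity (w l * (\sum_x k (s i + s l) x + e * \sum_x k (s i - s l) x)).
  rewrite mulr_sumr -big_split mulr_sumr /=; apply: eq_bigr => x _.
  by rewrite !bicharDl !(bicharC qk _ x); ring.
rewrite !bichar_sum addr_eq0 subr_eq0.
rewrite [LHS](_ : _ = #|V|%:R * (w l * ((s i == - s l)%:R + e * (s i == s l)%:R)));
  last by ring.
by rewrite (frame_delta fr) -[RHS]mulr_natr mulrCA mulrA.
Qed.


(** The composite [F D F] has kernel [\sum_x k b x * q x * k x c], which is
[G / q (b + c)] by completing the square, that is,
[G * (q b)^-1 * k b (- c) * (q c)^-1]: this is [D^-1 P F D^-1] up to [G]. *)
Lemma fourier_chirp e n (s : 'I_n -> V) w : parity_frame e s w ->
  chirp s q *m (fourier e s w k *m (chirp s q *m (fourier e s w k *m chirp s q)))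
    = (e * gauss_sum q) *: fourier e s w k.
Proof.
move=> fr; apply/matrixP => i l.
rewrite /chirp mul_diag_mx mul_mx_diag !mxE.
under eq_bigr do rewrite mul_diag_mx !mxE.
have := frame_sum fr (k (s i))
  (h := fun x => q x * (w l * (k x (s l) + e * k x (- s l)) * q (s l))).
move=> ->; last first.
  move=> x; rewrite (qcharN qk) !bicharNl -!bicharNr opprK.
  rewrite [in LHS](_ : k x (- s l) = e * e * k x (- s l)); first by ring.
  by rewrite (frame_sign fr) mul1r.
transitivity (q (s i) * q (s l) * w l *
   (\sum_x q x * k (s i + s l) x + e * \sum_x q x * k (s i - s l) x)).
  rewrite [e * _]mulr_sumr -big_split !mulr_sumr /=; apply: eq_bigr => x _.
  by rewrite !bicharDl !(bicharC qk _ x); ring.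
rewrite !gauss_sum_twist qcharB (qcharD qk) !bicharNr.
rewrite [RHS](_ : _ = gauss_sum q * w l *
  (e * k (s i) (s l) + e * e / k (s i) (s l))); last by ring.
rewrite (frame_sign fr); field.
by rewrite bichar_neq0 !(qchar_neq0 qk).
Qed.

(** Doubling permutes [I] up to signs, which the even function [q] ignores, and
raises [q] to the fourth power; so the product [p] satisfies [p ^ 4 = p]. *)
Lemma chirp_cube (I : {set V}) : half_set I ->
  (\prod_(i < #|I|) q (enum_val i)) ^+ 3 = 1.
Proof.
move=> hI.
have dbl_inj : injective (fun x : V => x + x).
  by move=> x y; apply: half_set_inj2 hI.
have dblN : {morph (fun x : V => x + x) : x / - x}.
  by move=> x; rewrite -opprD.
have [sigma sE] := half_set_act hI dbl_inj dblN.
have p0 : \prod_(i < #|I|) q (enum_val i) != 0.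
  by apply/prodf_neq0 => i _; apply: (qchar_neq0 qk).
apply: (mulfI p0); rewrite -exprS mulr1 -prodrXl.
rewrite [RHS](reindex_inj (@perm_inj _ sigma)) /=; apply: eq_bigr => i _.
by rewrite -qchar_double sE; case: ifP => // _; rewrite (qcharN qk).
Qed.

Lemma card_neq0 : (#|V|%:R : C) != 0.
Proof. by rewrite pnatr_eq0 -lt0n; apply/card_gt0P; exists 0. Qed.

(** Used also to see that [det F] is nonzero, which allows it to be cancelled in
[det_fourier]. *)
Lemma det_fourier_sqr e n (s : 'I_n -> V) w : parity_frame e s w ->
  (\det (fourier e s w k)) ^+ 2 = (e * #|V|%:R) ^+ n.
Proof. by move=> fr; rewrite expr2 -det_mulmx (fourier_sqr fr) det_scalar. Qed.

Lemma det_fourier e n (s : 'I_n -> V) w : parity_frame e s w ->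
  (\prod_i q (s i)) ^+ 3 = 1 ->
  \det (fourier e s w k) = (e * gauss_sum q) ^+ n.
Proof.
move=> fr p3; have := congr1 (@determinant _ _) (fourier_chirp fr).
rewrite detZ !det_mulmx /chirp det_diag.
under eq_bigr do rewrite mxE.
set p := \prod_i _ in p3 *; set d := \det _ => pd.
have d0 : d != 0.
  have : d ^+ 2 != 0.
    rewrite (det_fourier_sqr fr) expf_neq0 // mulf_neq0 ?card_neq0 //.
    by rewrite (frame_sign_neq0 fr).
  by rewrite expf_eq0.
apply: (mulIf d0); rewrite -pd -[LHS]mulr1 -p3; ring.
Qed.

Lemma det_odd_fourier (I : {set V}) : half_set I ->
  \det (fourier (-1) (@enum_val _ [in I]) (fun=> 1) k) = (- gauss_sum q) ^+ #|I|.
Proof.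
move=> hI; rewrite (det_fourier (odd_frame _ hI)) ?mulN1r //.
exact: chirp_cube.
Qed.

Lemma det_even_fourier (I : {set V}) : half_set I ->
  \det (fourier 1 (@even_point _ I) (@even_weight C #|I|) k)
    = gauss_sum q ^+ #|I|.+1.
Proof.
move=> hI; rewrite (det_fourier (even_frame _ hI)) ?mul1r //.
rewrite big_ord_recl /even_point unlift_none /= qchar0 mul1r.
under eq_bigr do rewrite liftK.
exact: chirp_cube.
Qed.

(** With [n = #|I|], the even frame gives [(G^2)^(n+1) = N^(n+1)] and the odd one
[(G^2)^n = (- N)^n]; the quotient is [G^2]. *)
Lemma gauss_sum_sqr (I : {set V}) : half_set I ->
  gauss_sum q ^+ 2 = (-1) ^+ #|I| * #|V|%:R.
Proof.
move=> hI; have := det_fourier_sqr (odd_frame _ hI).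
have := det_fourier_sqr (even_frame _ hI).
rewrite det_odd_fourier // det_even_fourier // mul1r mulN1r !(exprAC _ _ 2).
rewrite sqrrN => gS gn.
have nz : (- #|V|%:R : C) ^+ #|I| != 0 by rewrite expf_neq0 // oppr_eq0 card_neq0.
apply: (mulIf nz); rewrite -{1}gn -exprS gS mulrAC -exprMn mulN1r opprK.
by rewrite -exprSr.
Qed.

End Quadratic.

(** * Change of the Gauss sum under a substitution in the bicharacter *)

Section Act.
Variables (V : finZmodType) (C : numFieldType) (tau : V -> V).
Hypothesis tauN : {morph tau : x / - x}.
Variables (k k' : V -> V -> C).
Hypothesis kE : forall x y, k' x y = k x (tau y).

(** Column [j] of the matrix of [k'] is, up to the factor [e] produced by a
change of sign, column [sigma j] of the matrix of [k]. *)
Lemma det_fourier_act (e : C) n (s : 'I_n -> V) (w : 'I_n -> C)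
    (sigma : 'S_n) (b : pred 'I_n) :
    e * e = 1 -> (forall j, w (sigma j) = w j) ->
    (forall j, tau (s j) = if b j then s (sigma j) else - s (sigma j)) ->
  \det (fourier e s w k')
    = e ^+ #|[pred j | ~~ b j]| * (-1) ^+ sigma * \det (fourier e s w k).
Proof.
move=> ee wE sE.
have -> : fourier e s w k' = col_perm sigma (fourier e s w k)
    *m diag_mx (\row_j if b j then 1 else e).
  apply/matrixP => i j; rewrite mul_mx_diag !mxE !kE tauN sE wE.
  case: (b j); first by rewrite mulr1.
  rewrite opprK -mulrA; congr (_ * _).
  by rewrite mulrDl [e * _ * _]mulrAC ee mul1r addrC [_ * e]mulrC.
rewrite col_permE !det_mulmx det_diag det_perm odd_permV.
have -> : \prod_j (\row_j0 if b j0 then 1 else e) 0 j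
    = e ^+ #|[pred j | ~~ b j]|.
  rewrite -prodr_const [RHS]big_mkcond; apply: eq_bigr => j _.
  by rewrite mxE inE; case: (b j).
by rewrite mulrC [X in _ * X]mulrC mulrA.
Qed.

(** The signature of [sigma] enters the determinants of both sectors, whereas the
signs of [tau] on [I] only enter the odd one; the quotient keeps the latter
alone. *)
Lemma gauss_sum_act (q q' : V -> C) (I : {set V}) :
    half_set I -> injective tau ->
    quadratic_character q k -> quadratic_character q' k' ->
  gauss_sum q' = (-1) ^+ #|[set v in I | tau v \notin I]| * gauss_sum q.
Proof.
move=> hI tau_inj qk qk'.
have [sigma sE] := half_set_act hI tau_inj tauN.
pose b (i : 'I_#|I|) := tau (enum_val i) \in I.
have tau0 : tau 0 = 0 by apply: (half_set_eqN hI); rewrite -tauN oppr0.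
have cardb : #|[pred j | ~~ b j]| = #|[set v in I | tau v \notin I]|.
  rewrite -sum1dep_card big_mkcondr big_enum_val.
  by rewrite -[LHS]sum1_card big_mkcond.
pose b1 (i : 'I_#|I|.+1) := oapp b true (unlift ord0 i).
have sigma0 : lift0_perm sigma ord0 = ord0 by apply: lift0_perm0.
have wE j : even_weight C (lift0_perm sigma j) = even_weight C j.
  rewrite /even_weight; congr (if _ then _ else _).
  by rewrite -{1}sigma0 (inj_eq perm_inj).
have sE1 j : tau (even_point j) = if b1 j then even_point (lift0_perm sigma j)
    else - @even_point V I (lift0_perm sigma j).
  rewrite /even_point /b1; case: (unliftP ord0 j) => [i|] -> /=.
    by rewrite [lift0_perm _ _]lift0_perm_lift liftK /= sE.
  by rewrite sigma0 unlift_none.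
have := det_fourier_act (mulr1 1) wE sE1.
rewrite (det_even_fourier qk) // (det_even_fourier qk') // expr1n mul1r.
have -> : odd_perm (lift0_perm sigma) = sigma by rewrite odd_lift_perm.
have := det_fourier_act (w := fun=> 1) (frame_sign (odd_frame C hI))
  (fun=> erefl) sE.
rewrite (det_odd_fourier qk) // (det_odd_fourier qk') // cardb.
rewrite (exprNn (gauss_sum q)) (exprNn (gauss_sum q')) [X in _ = X -> _]mulrCA.
move/(mulfI (negbT (signr_eq0 C _))); set M := (-1) ^+ #|_| => odd_eq even_eq.
have G0 : gauss_sum q != 0.
  have : gauss_sum q ^+ 2 != 0.
    by rewrite (gauss_sum_sqr qk hI) mulf_neq0 ?signr_eq0 ?card_neq0.
  by rewrite expf_eq0.
have MM : M * M = 1 by rewrite -expr2 sqrr_sign.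
(* This is M G'^n: multiplying by it turns the goal into even_eq. *)
have nz : (-1) ^+ sigma * gauss_sum q ^+ #|I| != 0.
  by rewrite mulf_neq0 ?signr_eq0 ?expf_neq0.
apply: (mulIf nz); move: even_eq; rewrite !exprS odd_eq -mulrA => even_eq.
rewrite -[LHS]mul1r -[X in X * _ = _]MM -mulrA [M * (gauss_sum q' * _)]mulrCA even_eq -mulrA.
by congr (_ * _); rewrite mulrCA.
Qed.
End Act.

(** * Hermitian forms over a finite ring with involution *)

Section Hermitian.
Variables (R : realType) (B : finUnitRingType).
Hypothesis two_unit : (2%:R : B) \is a GRing.unit.
Variable star : B -> B.
Hypothesis star_inv : ring_involution star.
Variable beta : B -> R[i].
Hypothesis beta_char : additive_character beta.
Hypothesis beta_prim : primitive beta.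
Hypothesis beta_star : forall b : B, beta (b - star b) = 1.
Variable m : nat.

Lemma starD : {morph star : x y / x + y}. Proof. by case: star_inv. Qed.
Lemma starM x y : star (x * y) = star y * star x. Proof. by case: star_inv. Qed.
Lemma starK : involutive star. Proof. by case: star_inv. Qed.
Lemma star0 : star 0 = 0.
Proof. by apply: (addrI (star 0)); rewrite -starD !addr0. Qed.
Lemma starN x : star (- x) = - star x.
Proof. by apply: (addrI (star x)); rewrite -starD !subrr star0. Qed.

Lemma betaD x y : beta (x + y) = beta x * beta y.
Proof. by case: beta_char. Qed.

Lemma beta_neq0 x : beta x != 0. Proof. by case: beta_char. Qed.

(** This is the form in which the triviality of [beta] on [b - star b] is used:
it makes [pairing x (X *m y)] symmetric for Hermitian [X]. *)
Lemma beta_starE b : beta (star b) = beta b.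
Proof. by rewrite -{2}(subrK (star b) b) betaD beta_star mul1r. Qed.

Lemma adjmxD p r (x y : 'M[B]_(p, r)) :
  adjmx star (x + y) = adjmx star x + adjmx star y.
Proof. by apply/matrixP => i j; rewrite !mxE starD. Qed.

Lemma adjmxN p r (x : 'M[B]_(p, r)) : adjmx star (- x) = - adjmx star x.
Proof. by apply/matrixP => i j; rewrite !mxE starN. Qed.

Lemma adjmxM p r t (x : 'M[B]_(p, r)) (y : 'M[B]_(r, t)) :
  adjmx star (x *m y) = adjmx star y *m adjmx star x.
Proof.
apply/matrixP => i j; rewrite !mxE (big_morph star starD star0).
by apply: eq_bigr => l _; rewrite !mxE starM.
Qed.

Lemma adjmxK p r (x : 'M[B]_(p, r)) : adjmx star (adjmx star x) = x.
Proof. by apply/matrixP => i j; rewrite !mxE starK. Qed.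

Definition pairing (x y : 'cV[B]_m) : R[i] :=
  beta (((adjmx star x *m y) 0 0) *+ 2).

(** Letting [y] range over the multiples of the [i]-th basis vector shows that
[beta] is trivial on the right ideal generated by [star (x i 0)]; the division
by 2 absorbs the factor 2 of [pairing]. *)
Lemma pairing_nondeg (x : 'cV[B]_m) : (forall y, pairing x y = 1) -> x = 0.
Proof.
move=> x1; apply/matrixP => i j; rewrite mxE (ord1 j).
apply: (can_inj starK); rewrite star0.
pose J := [set star (x i 0) * b | b in [set: B]].
have J1 : star (x i 0) \in J by apply/imsetP; exists 1; rewrite ?inE ?mulr1.
suff J0 : J = [set 0] by move: J1; rewrite J0 inE => /eqP.
apply: beta_prim.
- split; last first.
    by move=> _ b /imsetP[c _ ->]; rewrite -mulrA imset_f ?inE.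
  split; first by apply/imsetP; exists 0; rewrite ?inE ?mulr0.
  by move=> _ _ /imsetP[c _ ->] /imsetP[d _ ->]; rewrite -mulrBr imset_f ?inE.
- move=> _ /imsetP[b _ ->].
  have := x1 (\col_l (if l == i then b / 2%:R else 0)).
  rewrite /pairing !mxE (bigD1 i) //= big1 => [|l /negbTE li].
    rewrite !mxE eqxx addr0 -mulr_natr -mulrA divrK //.
  by rewrite !mxE li mulr0.
Qed.

(** Polarizing [b^* X b] produces [x^* X y + y^* X x], whose second term is the
[star] of the first and so has the same image under [beta]. *)
Lemma herm_quadratic (X : 'M[B]_m) : X \in GLmx B m -> adjmx star X = X ->
  quadratic_character (beta \o herm_form star X)
                      (fun x y => pairing x (X *m y)).
Proof.
move=> XGL XH.
have flip (x y : 'cV[B]_m) : beta ((adjmx star y *m (X *m x)) 0 0)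
    = beta ((adjmx star x *m (X *m y)) 0 0).
  rewrite -beta_starE; congr beta.
  have adjE (z : 'M[B]_1) : adjmx star z 0 0 = star (z 0 0) by rewrite mxE.
  by rewrite -adjE !adjmxM XH adjmxK mulmxA.
split=> [x|x|x y|x y z|x y|x x1] /=; first exact: beta_neq0.
- by rewrite /herm_form adjmxN !mulNmx mulmxN opprK.
- have addE (z t : 'M[B]_1) : (z + t) 0 0 = z 0 0 + t 0 0 by rewrite mxE.
  rewrite /herm_form adjmxD !mulmxDl !mulmxDr !addE /pairing mulr2n.
  by rewrite !betaD -!mulmxA flip; ring.
- by rewrite /pairing !mulmxDr mxE mulrnDl betaD.
- by rewrite /pairing !mulr2n !betaD flip.
- move: XGL; rewrite inE => /existsP[Y /andP[/eqP XY _]].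
  apply: pairing_nondeg => y.
  by have := x1 (Y *m y); rewrite mulmxA XY mul1mx.
Qed.

(** As 2 is a unit, a nonzero [v] differs from [- v]: the pair [{v, - v}] has two
elements, exactly one of which lies in [I]. *)
Lemma half_systemP (I : {set 'cV[B]_m}) : half_system I -> half_set I.
Proof.
case=> I0 hI; split=> // v v0; have := hI v v0.
have vN : v != - v.
  apply: contraNneq v0 => vN; apply/eqP/matrixP => i j; rewrite mxE.
  apply: (mulrI two_unit); rewrite mulr0 mulr_natl mulr2n.
  by rewrite {1}vN mxE addNr.
case vI: (v \in I); case nvI: (- v \in I) => //.
  rewrite (setIidPr _) ?cards2 ?vN //.
  by apply/subsetP => x; rewrite !inE => /orP[] /eqP ->.
rewrite (_ : _ :&: _ = set0) ?cards0 //; apply/setP => x; rewrite !inE.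
by apply/negP => /andP[xI /orP[] /eqP xE]; rewrite xE ?vI ?nvI in xI.
Qed.

End Hermitian.

(** * The Gauss sum of a Hermitian form *)

Theorem theorem10p1 (R : realType) (B : finUnitRingType)
    (two_unit : (2%:R : B) \is a GRing.unit)
    (star : B -> B) (star_inv : ring_involution star)
    (beta : B -> R[i]) (beta_char : additive_character beta)
    (beta_prim : primitive beta)
    (beta_star : forall b : B, beta (b - star b) = 1)
    (m : nat) (m_ge1 : (1 <= m)%N)
    (I : {set 'cV[B]_m}) (I_half : half_system I)
    (T : 'M[B]_m) (T_GL : T \in GLmx B m) (T_herm : adjmx star T = T) :
  [/\ \sum_(b : 'cV[B]_m) beta (herm_form star T b)
        = \sum_(b : 'cV[B]_m) beta (herm_form star (GLinv T) b),
      \sum_(b : 'cV[B]_m) beta (herm_form star (GLinv T) b)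
        = (mu I T)%:~R
          * \sum_(b : 'cV[B]_m) beta ((adjmx star b *m b) 0 0) &
      (\sum_(b : 'cV[B]_m) beta (herm_form star T b)) ^+ 2
        = (-1) ^+ ((#|B| ^ m - 1) %/ 2)%N * (#|B| ^ m)%N%:R].
Proof.
have hI := half_systemP two_unit I_half.
have /andP[/eqP TY /eqP YT] : mx_inverses T (GLinv T).
  rewrite /GLinv; case: pickP => //= noY.
  by move: T_GL; rewrite inE => /existsP[Y]; rewrite noY.
have T_inj : injective (mulmx T : 'cV[B]_m -> 'cV[B]_m).
  by apply: (can_inj (g := mulmx (GLinv T))) => x; rewrite mulmxA YT mul1mx.
have T_opp : {morph (mulmx T : 'cV[B]_m -> 'cV[B]_m) : x / - x}.
  by move=> x; rewrite mulmxN.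
have qT := herm_quadratic two_unit star_inv beta_char beta_prim beta_star
  T_GL T_herm.
have one_GL : 1%:M \in GLmx B m.
  by rewrite inE; apply/existsP; exists 1%:M; rewrite /mx_inverses mulmx1 eqxx.
have one_herm : adjmx star (1%:M : 'M[B]_m) = 1%:M.
  apply/matrixP => i j; rewrite !mxE eq_sym; case: (i == j) => /=.
    by case: star_inv.
  exact: star0 star_inv.
have q1 := herm_quadratic two_unit star_inv beta_char beta_prim beta_star
  one_GL one_herm.
have inv_sum : \sum_(b : 'cV[B]_m) beta (herm_form star T b)
    = \sum_(b : 'cV[B]_m) beta (herm_form star (GLinv T) b).
  rewrite [RHS](reindex_inj T_inj) /=; apply: eq_bigr => b _.
  rewrite /herm_form (adjmxM star_inv) T_herm; congr (beta (_ 0 0)).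
  by rewrite !mulmxA -(mulmxA _ T (GLinv T)) TY mulmx1.
split=> //.
- rewrite -inv_sum.
  have := gauss_sum_act T_opp _ hI T_inj q1 qT.
  rewrite /gauss_sum => ->; last by move=> x y; rewrite mul1mx.
  congr (_ * _); last first.
    by apply: eq_bigr => b _; rewrite /= /herm_form mulmx1.
  rewrite /mu rmorphXn rmorphN1; congr (_ ^+ #|pred_of_set _|).
  apply/setP => v; rewrite !inE; case vI: (v \in I) => //=.
  have Tv0 : T *m v != 0.
    rewrite -(mulmx0 _ T) (inj_eq T_inj); exact: half_set_neq0 hI vI.
  rewrite -hI.2 //; apply/idP/imsetP => [h|[w wI ->]]; last by rewrite opprK.
  by exists (- (T *m v)); rewrite ?opprK.
- have cV : #|{: 'cV[B]_m}| = (#|B| ^ m)%N by rewrite card_mx muln1.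
  have := gauss_sum_sqr qT hI; rewrite /gauss_sum => ->.
  by rewrite -cV (card_half_set hI) subn1 /= -muln2 mulnK.
Qed.
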